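(* Let $\theta$ and $\rho$ be regular infinite cardinals with $\theta < \rho < \kappa$, and let $S$ be a stationary subset of $E^\kappa_\theta$ that reflects fully in $E^\kappa_{\geq\rho}$. Suppose that either $\theta > \omega$, or $\rho \geq \omega_2$. Then, setting $J = NS_\kappa | S$, there is either a descending $(J, I_\kappa)$-tower of length $\mathfrak{b}_\kappa$, or an ascending $(J, I_\kappa)$-tower of length $\kappa^+$.
   Context: $\kappa$ is a regular uncountable cardinal. $acc(\kappa)$ is the set of nonzero limit ordinals below $\kappa$; $E^\kappa_\theta = \{\alpha \in acc(\kappa) : \mathrm{cf}(\alpha) = \theta\}$ and $E^\kappa_{\geq\rho} = \{\alpha \in acc(\kappa) : \mathrm{cf}(\alpha) \geq \rho\}$. A stationary $S \subseteq \kappa$ reflects at $\gamma \in E^\kappa_{\geq\omega_1}$ if $S \cap \gamma$ is stationary in $\gamma$; $S$ reflects fully in a stationary $T \subseteq E^\kappa_{\geq\omega_1}$ if there is a closed unbounded $G \subseteq \kappa$ such that $S$ reflects at every $\gamma \in G \cap T$. $NS_\kappa|S = \{B \subseteq \kappa : B \cap S \text{ is nonstationary}\}$. $I_\kappa$ is the ideal of bounded subsets of $\kappa$. For $f,g \in {}^\kappa\kappa$, $f <^* g$ means $|\{\alpha : f(\alpha)\geq g(\alpha)\}|<\kappa$; $\mathfrak{b}_\kappa$ is the least cardinality of an $F \subseteq {}^\kappa\kappa$ with no $g \in {}^\kappa\kappa$ such that $f <^* g$ for all $f \in F$. For an ideal $J$ on $\kappa$ (with $J^+ = P(\kappa)\setminus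 J$) and $Y \subseteq P(\kappa)$, a descending (respectively, ascending) $(J,Y)$-tower of length $\delta$ is $\langle A_\alpha : \alpha < \delta\rangle$ with each $A_\alpha \in J^+$ such that for $\alpha < \beta < \delta$: $A_\beta \setminus A_\alpha \in Y$ and $A_\alpha \setminus A_\beta \in J^+$ (respectively, $A_\alpha \setminus A_\beta \in Y$ and $A_\beta \setminus A_\alpha \in J^+$). *)

(* Defs.v *)
(* plain Rocq.  The cardinal kappa is modelled as a type K
   well-ordered by lt (its elements are the ordinals below kappa).  Other
   index sets (lengths of towers) are well-ordered types; cardinalities are
   compared by injections. *)

Set Implicit Arguments.

Definition card_le (A B : Type) : Prop :=
  exists f : A -> B, forall x y, f x = f y -> x = y.
Definition card_lt (A B : Type) : Prop := card_le A B /\ ~ card_le B A.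

Definition wellorder (I : Type) (r : I -> I -> Prop) : Prop :=
  (forall x, ~ r x x) /\
  (forall x y z, r x y -> r y z -> r x z) /\
  (forall x y, r x y \/ x = y \/ r y x) /\
  well_founded r.

Definition initseg (I : Type) (r : I -> I -> Prop) (i : I) : Type :=
  { j : I | r j i }.

Section Kappa.
Variables (K : Type) (lt : K -> K -> Prop).

Definition le (a b : K) : Prop := lt a b \/ a = b.

Definition regular_uncountable : Prop :=
  wellorder lt /\
  (forall a, card_lt (initseg lt a) K) /\
  (forall X : K -> Prop, (forall a, exists x, X x /\ lt a x) ->
      card_le K { x : K | X x }) /\
  ~ card_le K nat.

Definition is_limit (a : K) : Prop :=
  (exists b, lt b a) /\ forall b, lt b a -> exists c, lt b c /\ lt c a.

Definition cofinal_from (gamma alpha : K) : Prop :=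
  exists f : initseg lt gamma -> K,
    (forall d, lt (f d) alpha) /\
    (forall b, lt b alpha -> exists d, le b (f d)).

Definition has_cf (alpha theta : K) : Prop :=
  cofinal_from theta alpha /\ forall g, lt g theta -> ~ cofinal_from g alpha.

Definition regular_infinite (theta : K) : Prop :=
  is_limit theta /\ has_cf theta theta.

Definition uncountable_ord (g : K) : Prop := ~ card_le (initseg lt g) nat.

Definition E_eq (theta : K) (a : K) : Prop := is_limit a /\ has_cf a theta.
Definition E_ge (rho : K) (a : K) : Prop :=
  is_limit a /\ exists t, has_cf a t /\ le rho t.

Definition unbounded (C : K -> Prop) : Prop :=
  forall a, exists c, C c /\ lt a c.
Definition closed (C : K -> Prop) : Prop :=
  forall a, is_limit a -> (forall b, lt b a -> exists c, C c /\ lt b c /\ lt c a) -> C a.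
Definition club (C : K -> Prop) : Prop := unbounded C /\ closed C.
Definition stationary (S : K -> Prop) : Prop :=
  forall C, club C -> exists a, S a /\ C a.

Definition club_in (gamma : K) (C : K -> Prop) : Prop :=
  (forall c, C c -> lt c gamma) /\
  (forall b, lt b gamma -> exists c, C c /\ lt b c) /\
  (forall a, lt a gamma -> is_limit a ->
     (forall b, lt b a -> exists c, C c /\ lt b c /\ lt c a) -> C a).
Definition stationary_in (gamma : K) (S : K -> Prop) : Prop :=
  forall C, club_in gamma C -> exists a, lt a gamma /\ S a /\ C a.

Definition reflects_at (S : K -> Prop) (gamma : K) : Prop :=
  stationary_in gamma (fun x => S x /\ lt x gamma).
Definition reflects_fully (S T : K -> Prop) : Prop :=
  exists G, club G /\ forall g, G g -> T g -> reflects_at S g.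

Definition NS_restr (S : K -> Prop) (B : K -> Prop) : Prop :=
  ~ stationary (fun x => B x /\ S x).
Definition bounded_ideal (B : K -> Prop) : Prop :=
  exists a, forall x, B x -> lt x a.

Definition setminus (A B : K -> Prop) : K -> Prop := fun x => A x /\ ~ B x.

Definition desc_tower (J Y : (K -> Prop) -> Prop) (I : Type) (r : I -> I -> Prop)
  (A : I -> K -> Prop) : Prop :=
  (forall i, ~ J (A i)) /\
  forall i j, r i j -> Y (setminus (A j) (A i)) /\ ~ J (setminus (A i) (A j)).
Definition asc_tower (J Y : (K -> Prop) -> Prop) (I : Type) (r : I -> I -> Prop)
  (A : I -> K -> Prop) : Prop :=
  (forall i, ~ J (A i)) /\
  forall i j, r i j -> Y (setminus (A i) (A j)) /\ ~ J (setminus (A j) (A i)).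

Definition ltstar (f g : K -> K) : Prop :=
  card_lt { a : K | ~ lt (f a) (g a) } K.
Definition dominated (J : Type) (F : J -> K -> K) : Prop :=
  exists g, forall j, ltstar (F j) g.

Definition card_is_bkappa (I : Type) : Prop :=
  (exists F : I -> K -> K, ~ dominated F) /\
  (forall (J : Type) (F : J -> K -> K), card_lt J I -> dominated F).

Definition ordertype_bkappa (I : Type) (r : I -> I -> Prop) : Prop :=
  wellorder r /\ (forall i, card_lt (initseg r i) I) /\ card_is_bkappa I.

Definition ordertype_kplus (I : Type) (r : I -> I -> Prop) : Prop :=
  wellorder r /\ (forall i, card_le (initseg r i) K) /\ ~ card_le I K.

End Kappa.

(* Main.v *)
(* The ascending alternative always holds: it amounts to the failure of kappa^+-saturation of
   NS_kappa|S, in the spirit of Gitik and Shelah. Without an ascending tower of length kappa^+,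
   every normal ideal has a largest element modulo sets nonstationary in S. Starting from
   Shelah's club guessing, two applications of this principle yield sets N_d, unbounded in d and
   consisting of ordinals of cofinality at least rho, such that for every club D, almost every d
   in S satisfies N_d <=* D. Iterate: let E_lam be the intersection of clubs E_i (i < lam) with
   E_{i+1} inside acc(E_i) and N_d <=* E_i for all d in S and E_{i+1}, where lam is regular,
   lam < rho and lam <> theta; then N_d <=* E_lam for d in S and E_lam. Every point of cofinality
   at least rho in all the acc(E_i) lies in acc(E_lam). At the least such point gamma the set S
   reflects, so some d in S and E_lam lies below gamma, and N_d contains a smaller such point. *)

Require Import Defs.
From mathcomp Require eqtype boolp wochoice.
From Stdlib Require Import Classical ClassicalEpsilon Cantor Inverse_Image
  FunctionalExtensionality PropExtensionality PeanoNat.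

(** * Choice, well-orderings and the successor cardinal *)

Lemma choice (A B : Type) (R : A -> B -> Prop) :
  (forall x, exists y, R x y) -> exists f : A -> B, forall x, R x (f x).
Proof.
  intros H. exists (fun x => proj1_sig (constructive_indefinite_description _ (H x))).
  intros x. apply proj2_sig.
Qed.

Lemma wf_least (A : Type) (r : A -> A -> Prop) (P : A -> Prop) :
  well_founded r -> (exists x, P x) -> exists x, P x /\ forall y, r y x -> ~ P y.
Proof.
  intros wf [x Px]. revert Px. induction (wf x) as [x _ IH]. intros Px.
  destruct (classic (exists y, r y x /\ P y)) as [[y [ryx Py]]|N].
  - exact (IH y ryx Py).
  - exists x. split; [exact Px|]. intros y ryx Py. apply N. now exists y.
Qed.

(** The principle from MathComp gives a boolean relation under which every inhabited predicate has a
    unique minimum. Minima of sets of one, two or three elements yield the order axioms, uniqueness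
    giving antisymmetry; the strict part is the required order. *)
Lemma well_ordering (T : Type) : exists r : T -> T -> Prop, wellorder r.
Proof.
  revert T. apply boolp.Peq. intros T.
  destruct (wochoice.well_ordering_principle T) as [R HR]. revert R HR.
  generalize (eqtype.Equality.sort T) as U. clear T. intros T R HR.
  assert (least : forall P : T -> Prop, (exists x, P x) ->
            exists z, P z /\ forall x, P x -> R z x = true).
  { intros P [x0 Px0].
    destruct (HR (fun x : T => boolp.asbool (P x))) as [z [[Az lb] _]].
    - exists x0. apply (boolp.asboolT Px0).
    - exists z. split.
      + apply (boolp.asboolW Az).
      + intros x Px. apply lb. apply (boolp.asboolT Px). }
  assert (refl : forall x, R x x = true).
  { intros x. destruct (least (fun y => y = x)) as [z [-> lb]]; [now exists x|].
    now apply lb. }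
  assert (anti : forall x y, R x y = true -> R y x = true -> x = y).
  { intros x y xy yx.
    destruct (HR (fun z : T => boolp.asbool (z = x \/ z = y))) as [z [_ uz]].
    - exists x. apply boolp.asboolT. now left.
    - transitivity z; [symmetry|]; apply uz; split.
      + apply boolp.asboolT. now left.
      + intros t At. apply boolp.asboolW in At. destruct At as [->| ->]; auto.
      + apply boolp.asboolT. now right.
      + intros t At. apply boolp.asboolW in At. destruct At as [->| ->]; auto. }
  assert (tot : forall x y, R x y = true \/ R y x = true).
  { intros x y. destruct (least (fun z => z = x \/ z = y)) as [z [[->| ->] lb]];
      [exists x; now left|left|right]; apply lb; auto. }
  assert (trans : forall x y z, R x y = true -> R y z = true -> R x z = true).
  { intros x y z xy yz.
    destruct (least (fun t => t = x \/ t = y \/ t = z)) as [t [[->|[->| ->]] lb]].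
    - exists x; now left.
    - apply lb; auto.
    - assert (x = y) as -> by (apply anti; [|apply lb]; auto). exact yz.
    - assert (y = z) as -> by (apply anti; [|apply lb]; auto). exact xy. }
  exists (fun x y => R x y = true /\ x <> y). split; [|split; [|split]].
  - intros x [_ n]. now apply n.
  - intros x y z [xy n] [yz m]. split; [eauto|]. intros ->. apply m. auto.
  - intros x y. destruct (classic (x = y)) as [e|n]; [auto|].
    destruct (tot x y); [left|right; right]; split; auto.
  - intros x. apply NNPP. intros N.
    destruct (least (fun y => ~ Acc (fun a b => R a b = true /\ a <> b) y)) as [z [Nz lb]];
      [now exists x|].
    apply Nz. constructor. intros y [yz ne]. apply NNPP. intros Ny.
    apply ne, anti; auto.
Qed.

Lemma card_le_trans (A B C : Type) : card_le A B -> card_le B C -> card_le A C.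
Proof. intros [f Hf] [g Hg]. exists (fun x => g (f x)). auto. Qed.

Lemma not_card_le_powerset (A : Type) : ~ card_le (A -> Prop) A.
Proof.
  intros [f inj].
  set (D := fun a => exists P, f P = a /\ ~ P a).
  assert (N : ~ D (f D)).
  { intros [P [e n]]. apply inj in e. subst P. apply n. exists D. auto. }
  apply N. exists D. auto.
Qed.

(** Hartogs' argument inside a well-ordering of the power set of [K]: cut at the least point whose
    initial segment does not embed in [K], or keep the whole order if there is no such point. *)
Lemma exists_kplus (K : Type) : exists (I : Type) (r : I -> I -> Prop), ordertype_kplus K r.
Proof.
  destruct (well_ordering (K -> Prop)) as [r [irr [tr [tot wf]]]].
  destruct (classic (exists p, ~ card_le (initseg r p) K)) as [ex|N].
  - destruct (wf_least _ _ _ wf ex) as [p [Np lt_p]].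
    exists (initseg r p), (fun a b => r (proj1_sig a) (proj1_sig b)).
    split; [split; [|split; [|split]]|split]; eauto.
    + intros [a ha] [b hb]. simpl. destruct (tot a b) as [h|[h|h]]; auto.
      right. left. subst. now rewrite (proof_irrelevance _ ha hb).
    + apply (wf_inverse_image _ _ _ (fun a : initseg r p => proj1_sig a) wf).
    + intros [a ha].
      apply card_le_trans with (initseg r a).
      * exists (fun b => exist (fun j => r j a) (proj1_sig (proj1_sig b)) (proj2_sig b)).
        intros [[x hx] ux] [[y hy] uy]. simpl in *. intros e. injection e as ->.
        rewrite (proof_irrelevance _ hx hy) in *. now rewrite (proof_irrelevance _ ux uy).
      * apply NNPP. exact (lt_p a ha).
  - exists (K -> Prop), r. split; [split; [|split; [|split]]|split]; auto.
    + intros p. apply NNPP. intros n. apply N. now exists p.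
    + apply not_card_le_powerset.
Qed.

Lemma omega_sequence (A : Type) (U : A -> Prop) (R : A -> A -> Prop) :
  (forall a, U a -> exists b, U b /\ R a b) ->
  forall a, U a -> exists x : nat -> A, x 0 = a /\ forall n, U (x n) /\ R (x n) (x (S n)).
Proof.
  intros step a Ua.
  destruct (choice _ _ (fun p q : {a | U a} => R (proj1_sig p) (proj1_sig q))) as [f Hf].
  { intros [p Up]. destruct (step p Up) as [b [Ub Rb]]. now exists (exist _ b Ub). }
  exists (fun n => proj1_sig (Nat.iter n f (exist _ a Ua))). split; [reflexivity|].
  intros n. split; [apply proj2_sig|apply Hf].
Qed.

Lemma card_le_of_surjection (A B : Type) (P : A -> Prop) (f : B -> A) :
  (forall a, P a -> exists b, f b = a) -> card_le {a | P a} B.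
Proof.
  intros sur. destruct (choice _ _ (fun (a : {a | P a}) b => f b = proj1_sig a)) as [g Hg].
  { intros [a Pa]. now apply sur. }
  exists g. intros [a Pa] [b Pb] e. assert (a = b) as ->.
  { specialize (Hg (exist _ a Pa)) as ha. specialize (Hg (exist _ b Pb)) as hb.
    simpl in *. congruence. }
  now rewrite (proof_irrelevance _ Pa Pb).
Qed.

(* In [G a R], the relation [R] is the graph of the function below [a]. *)
Lemma transfinite_recursion (A V : Type) (r : A -> A -> Prop) :
  well_founded r -> forall G : A -> (A -> V -> Prop) -> V,
  exists f : A -> V, forall a, f a = G a (fun b v => exists _ : r b a, v = f b).
Proof.
  intros wf G.
  exists (Fix wf (fun _ => V) (fun a rec => G a (fun b v => exists h : r b a, v = rec b h))).
  intros a. rewrite Fix_eq; [reflexivity|].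
  intros x f g E. assert (f = g) as ->; [|reflexivity].
  apply functional_extensionality_dep. intros y. now apply functional_extensionality_dep.
Qed.

(** * The order on kappa, suprema and closure points *)

Section Kappa.
Variables (K : Type) (lt : K -> K -> Prop).
Hypothesis Hwo : wellorder lt.
Local Infix "<<" := lt (at level 70).
Local Notation le := (le lt).
Local Notation is_limit := (is_limit lt).

Lemma lt_irrefl x : ~ x << x. Proof. apply Hwo. Qed.
Lemma lt_trans x y z : x << y -> y << z -> x << z. Proof. apply Hwo. Qed.
Lemma lt_wf : well_founded lt. Proof. apply Hwo. Qed.
Lemma lt_le_trans x y z : x << y -> le y z -> x << z.
Proof. intros h [h'|<-]; [eapply lt_trans|]; eauto. Qed.
Lemma le_lt_trans x y z : le x y -> y << z -> x << z.
Proof. intros [h'| ->] h; [eapply lt_trans|]; eauto. Qed.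
Lemma le_trans x y z : le x y -> le y z -> le x z.
Proof. intros [h| ->] h'; [left; eapply lt_le_trans|]; eauto. Qed.
Lemma le_or_lt x y : le x y \/ y << x.
Proof.
  destruct (proj1 (proj2 (proj2 Hwo)) x y) as [h|[h|h]]; [left; left|left; right|right]; exact h.
Qed.
Lemma le_not_lt x y : le x y -> ~ y << x.
Proof. intros h h'. exact (lt_irrefl x (le_lt_trans _ _ _ h h')). Qed.
Lemma not_lt_le x y : ~ y << x -> le x y.
Proof. destruct (le_or_lt x y); tauto. Qed.
Lemma lt_le x y : x << y -> le x y. Proof. now left. Qed.
Lemma le_refl x : le x x. Proof. now right. Qed.
Lemma le_antisym x y : le x y -> le y x -> x = y.
Proof. intros [h|h] h'; [destruct (le_not_lt _ _ h' h)|exact h]. Qed.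
Hint Resolve lt_trans lt_le_trans le_lt_trans le_trans lt_le le_refl : core.

Lemma max_lt a b c : a << c -> b << c -> exists m, m << c /\ le a m /\ le b m.
Proof. intros. destruct (le_or_lt a b); [exists b|exists a]; auto. Qed.

Lemma least (P : K -> Prop) : (exists x, P x) -> exists x, P x /\ forall y, P y -> le x y.
Proof.
  intros ex. destruct (wf_least _ _ P lt_wf ex) as [x [Px Hx]].
  exists x. split; [exact Px|]. intros y Py. apply not_lt_le. intros h. exact (Hx y h Py).
Qed.

Lemma sup_exists (X : K -> Prop) b : (forall x, X x -> le x b) ->
  exists s, le s b /\ (forall x, X x -> le x s) /\ forall y, y << s -> exists x, X x /\ y << x.
Proof.
  intros ub. destruct (least (fun s => forall x, X x -> le x s)) as [s [us ls]]; [eauto|].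
  exists s. split; [now apply ls|split; [exact us|]].
  intros y h. apply NNPP. intros N. apply (le_not_lt s y); [|exact h].
  apply ls. intros x Xx. apply not_lt_le. eauto.
Qed.

Definition acc (D : K -> Prop) (a : K) : Prop :=
  is_limit a /\ forall b, b << a -> exists c, D c /\ b << c /\ c << a.

Lemma club_acc_in D a : club lt D -> acc D a -> D a.
Proof. intros [_ cl] [lim h]. now apply cl. Qed.

(** The point [b] is the supremum of omega many [R]-steps. The predicate [U] allows the same
    argument in all of kappa and below a single ordinal. *)
Lemma omega_closure (U : K -> Prop) (R : K -> K -> Prop) :
  (forall f : nat -> K, (forall n, U (f n)) -> exists b, U b /\ forall n, f n << b) ->
  (forall a b, a << b -> U b -> U a) ->
  (forall a, U a -> exists b, U b /\ a << b /\ R a b) ->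
  forall a, U a -> exists x b, U b /\ a << b /\ is_limit b /\
    (forall n, x n << b /\ x n << x (S n) /\ R (x n) (x (S n))) /\
    forall y, y << b -> exists n, y << x n.
Proof.
  intros bnd down step a Ua.
  destruct (omega_sequence _ U (fun a b => a << b /\ R a b) step a Ua) as [x [x0 Hx]].
  destruct (bnd x) as [c [Uc xc]]; [intros; apply Hx|].
  destruct (sup_exists (fun y => exists n, y = x n) c) as [b [bc [ub lb]]].
  { intros y [n ->]. auto. }
  assert (xb : forall n, x n << b).
  { intros n. apply lt_le_trans with (x (S n)); [apply Hx|]. apply ub. eauto. }
  assert (cof : forall y, y << b -> exists n, y << x n).
  { intros y h. destruct (lb y h) as [z [[n ->] h']]. eauto. }
  exists x, b. split.
  { destruct bc as [bc| ->]; eauto. }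
  split; [rewrite <- x0; apply xb|]. split; [split|split].
  - exists (x 0). apply xb.
  - intros y h. destruct (cof y h) as [n hn]. eauto.
  - intros n. split; [|split]; [apply xb|apply Hx|apply Hx].
  - exact cof.
Qed.

(* [W a i] says that the [i]-th set is relevant at level [a]; [i << j] (fixed [j]) gives
   intersections of fewer than kappa sets, and [i << a] gives diagonal intersections.
   The initial segment [U] is either all of [K] or [{y | y << x}]. *)
Lemma closing_point (U : K -> Prop) (W C : K -> K -> Prop) :
  (forall f : nat -> K, (forall n, U (f n)) -> exists b, U b /\ forall n, f n << b) ->
  (forall a b, a << b -> U b -> U a) ->
  (forall a b i, W a i -> a << b -> W b i) ->
  (forall b i, is_limit b -> W b i -> exists a, a << b /\ W a i) ->
  (forall a (f : K -> K), U a -> (forall i, W a i -> U (f i)) ->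
     exists b, U b /\ forall i, W a i -> f i << b) ->
  (forall a i, U a -> W a i -> exists c, C i c /\ U c /\ a << c) ->
  (forall a i, U a -> acc (C i) a -> C i a) ->
  forall a, U a -> exists b, U b /\ a << b /\ is_limit b /\ forall i, W b i -> C i b.
Proof.
  intros bnd down Wm Wc Wb Cu Cc.
  assert (up : forall a, U a -> exists b, U b /\ a << b).
  { intros a Ua. destruct (bnd (fun _ => a)) as [b [Ub h]]; auto. exists b. split; auto.
    now apply (h 0). }
  intros a Ua.
  destruct (omega_closure U (fun a b => forall i, W a i -> exists c, C i c /\ a << c /\ c << b))
    with (a := a) as [x [b [Ub [ab [lim [Hx cof]]]]]]; auto.
  - clear a Ua. intros a Ua.
    destruct (choice _ _ (fun i c => W a i -> C i c /\ U c /\ a << c)) as [f Hf].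
    { intros i. destruct (classic (W a i)) as [Wi|N].
      - destruct (Cu a i Ua Wi) as [c Hc]. now exists c.
      - exists a. tauto. }
    destruct (Wb a f Ua) as [b [Ub Hb]]; [intros; now apply Hf|].
    destruct (up a Ua) as [b' [Ub' ab']].
    assert (exists d, U d /\ le b d /\ le b' d) as [d [Ud [bd bd']]].
    { destruct (le_or_lt b b'); [exists b'|exists b]; auto. }
    exists d. split; [auto|split; [eauto|]].
    intros i Wi. exists (f i). split; [now apply Hf|]. split; [now apply Hf|eauto].
  - exists b. split; [auto|split; [auto|split; [auto|]]].
    intros i Wi. apply Cc; [auto|]. split; [exact lim|].
    intros y yb. destruct (Wc b i lim Wi) as [a' [ab' Wi']].
    destruct (max_lt _ _ _ yb ab') as [m [mb [ym am]]].
    destruct (cof m mb) as [n mn].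
    assert (W (x n) i) as Wn by eauto.
    destruct (Hx n) as [_ [_ Hn]]. destruct (Hn i Wn) as [c [Cc' [xc cx]]].
    exists c. split; [auto|]. split; [eauto|]. apply lt_trans with (x (S n)); [auto|apply Hx].
Qed.

(** * Regularity of kappa; clubs and stationary sets *)

Hypothesis Hkappa : regular_uncountable lt.
(** Some limit ordinal, which makes kappa infinite and supplies default values; the main proof takes
    [theta]. *)
Variable t : K.
Hypothesis Ht : is_limit t.

Lemma increasing_sequence_below a : is_limit a ->
  exists s : nat -> K, (forall n, s n << a) /\ forall n m, n < m -> s n << s m.
Proof.
  intros [[b ba] dense].
  destruct (omega_sequence K (fun x => x << a) lt) with (a := b) as [s [_ Hs]]; auto.
  { intros x xa. destruct (dense x xa) as [c [? ?]]. now exists c. }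
  exists s. split; [apply Hs|]. induction 1; [apply Hs|]. eapply lt_trans; eauto. apply Hs.
Qed.

Lemma increasing_injective (s : nat -> K) :
  (forall n m, n < m -> s n << s m) -> forall n m, s n = s m -> n = m.
Proof.
  intros Hs n m e. destruct (Nat.lt_trichotomy n m) as [h|[h|h]]; auto;
    apply Hs in h; rewrite e in h; now apply lt_irrefl in h.
Qed.

(* A last element [m] could be absorbed by Hilbert's hotel into [initseg m]. *)
Lemma unbounded_above a : exists b, a << b.
Proof.
  apply NNPP. intros N.
  assert (top : forall b, le b a).
  { intros b. apply not_lt_le. intros h. apply N. eauto. }
  destruct (increasing_sequence_below t Ht) as [s [st inc]].
  pose proof (increasing_injective s inc) as inj.
  assert (sa : forall n, s n << a) by (intros n; eapply lt_le_trans; eauto).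
  destruct (proj1 (proj2 Hkappa) a) as [_ n]. apply n.
  destruct (choice _ _ (fun x (y : initseg lt a) =>
      (x = a /\ proj1_sig y = s 0) \/ (exists n, x = s n /\ proj1_sig y = s (S n)) \/
      (x <> a /\ (forall n, x <> s n) /\ proj1_sig y = x))) as [f Hf].
  { intros x. destruct (classic (x = a)) as [e|ne].
    - exists (exist _ (s 0) (sa 0)). auto.
    - destruct (classic (exists n, x = s n)) as [[k e]|nex].
      + exists (exist _ (s (S k)) (sa (S k))). eauto.
      + assert (xa : x << a) by (destruct (top x); tauto).
        exists (exist _ x xa). right. right. split; [auto|split; [|reflexivity]].
        intros k e. eauto. }
  exists f. intros x y e. specialize (Hf x) as hx. specialize (Hf y) as hy. rewrite e in hx.
  destruct hx as [[ex hx]|[[k [ex hx]]|[nx [mx hx]]]];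
    destruct hy as [[ey hy]|[[l [ey hy]]|[ny [my hy]]]]; rewrite hx in hy; subst;
    solve [ reflexivity | assumption | apply inj in hy; congruence | now destruct (my 0)
          | now destruct (my (S k)) | now destruct (mx 0) | now destruct (mx (S l)) ].
Qed.

(** An unbounded range would have size kappa by regularity, and choosing preimages would embed kappa
    into [I]. *)
Lemma bounded_of_small (I : Type) (f : I -> K) : ~ card_le K I -> exists b, forall i, f i << b.
Proof.
  intros small. apply NNPP. intros N. apply small.
  apply card_le_trans with {x | exists i, f i = x}.
  - apply (proj1 (proj2 (proj2 Hkappa))). intros a. apply NNPP. intros n.
    destruct (unbounded_above a) as [b ab]. apply N. exists b. intros i.
    destruct (le_or_lt (f i) a); eauto. destruct n. eauto.
  - now apply card_le_of_surjection with f.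
Qed.

Lemma bounded_initseg j (f : K -> K) : exists b, forall i, i << j -> f i << b.
Proof.
  destruct (bounded_of_small (initseg lt j) (fun i => f (proj1_sig i))) as [b Hb].
  - apply (proj1 (proj2 Hkappa)).
  - exists b. intros i ij. exact (Hb (exist _ i ij)).
Qed.

Lemma bounded_nat (f : nat -> K) : exists b, forall n, f n << b.
Proof. apply bounded_of_small. apply Hkappa. Qed.

Lemma club_of_relevance (W C : K -> K -> Prop) :
  (forall a b i, W a i -> a << b -> W b i) ->
  (forall b i, is_limit b -> W b i -> exists a, a << b /\ W a i) ->
  (forall a, exists j, forall i, W a i -> i << j) ->
  (forall a i, W a i -> club lt (C i)) ->
  club lt (fun b => forall i, W b i -> C i b).
Proof.
  intros Wm Wc Wj HC. split.
  - intros a.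
    (* [closing_point] asks for closure of every [C i], relevant or not, so a set that is not a club
       is enlarged to all of kappa. *)
    destruct (closing_point (fun _ => True) W
                (fun i x => C i x \/ ~ club lt (C i))) with (a := a)
      as [b [_ [ab [lim Hb]]]]; auto.
    + intros f _. destruct (bounded_nat f) as [b Hb]. eauto.
    + intros c f _ _. destruct (Wj c) as [j Hj]. destruct (bounded_initseg j f) as [b Hb]. eauto.
    + intros c i _ Wi. destruct (HC c i Wi) as [unb _]. destruct (unb c) as [d [? ?]]. eauto.
    + intros c i _ [lim H]. destruct (classic (club lt (C i))) as [cl|]; auto. left.
      apply club_acc_in; auto. split; auto. intros y yc.
      destruct (H y yc) as [d [[?|?] ?]]; [eauto|tauto].
    + exists b. split; auto. intros i Wi. destruct (Hb i Wi) as [|n]; auto.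
      now apply HC in Wi.
  - intros b lim H i Wi. apply club_acc_in; [eauto|]. split; auto.
    intros y yb. destruct (Wc b i lim Wi) as [a [ab Wa]].
    destruct (max_lt _ _ _ yb ab) as [m [mb [ym am]]].
    destruct (H m mb) as [c [Hc [mc cb]]]. exists c. split; [apply Hc|]; eauto.
Qed.

Lemma club_inter_below j (C : K -> K -> Prop) :
  (forall i, i << j -> club lt (C i)) -> club lt (fun b => forall i, i << j -> C i b).
Proof.
  intros HC. apply (club_of_relevance (fun _ i => i << j)); eauto.
  intros b i [[a ab] _] ij. eauto.
Qed.

Lemma club_diagonal (C : K -> K -> Prop) :
  (forall i, club lt (C i)) -> club lt (fun b => forall i, i << b -> C i b).
Proof.
  intros HC. apply (club_of_relevance (fun b i => i << b)); eauto.
  intros b i [_ lim] ib. destruct (lim i ib) as [c [? ?]]. eauto.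
Qed.

Lemma club_inter (C D : K -> Prop) : club lt C -> club lt D -> club lt (fun x => C x /\ D x).
Proof.
  intros HC HD. destruct Ht as [[a at'] dense]. destruct (dense a at') as [b [ab bt]].
  (* The family is [C] at the index [a] and [D] at all others, among them [b]. *)
  destruct (club_inter_below t (fun i x => (i = a -> C x) /\ (i <> a -> D x))) as [u c].
  - intros i _. destruct (classic (i = a)) as [e|n].
    + split; [intros x; destruct (proj1 HC x) as [y [? ?]]; exists y; tauto|].
      intros x lim H. split; [|tauto]. intros _. apply (proj2 HC); auto.
      intros y yx. destruct (H y yx) as [z [? ?]]. exists z. tauto.
    + split; [intros x; destruct (proj1 HD x) as [y [? ?]]; exists y; tauto|].
      intros x lim H. split; [tauto|]. intros _. apply (proj2 HD); auto.
      intros y yx. destruct (H y yx) as [z [? ?]]. exists z. tauto.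
  - assert (E : forall x, (forall i, i << t -> (i = a -> C x) /\ (i <> a -> D x)) <-> C x /\ D x).
    { intros x. split; [|tauto]. intros H. split; [now apply (H a at')|].
      apply (H b bt). intros ->. now apply lt_irrefl in ab. }
    split.
    + intros x. destruct (u x) as [y [Hy xy]]. apply E in Hy. eauto.
    + intros x lim H. apply E. apply c; auto. intros y yx. destruct (H y yx) as [z [Hz ?]].
      exists z. split; auto. now apply E.
Qed.

Lemma club_tail a : club lt (fun x => a << x).
Proof.
  split.
  - intros b. destruct (unbounded_above a) as [c ac]. destruct (unbounded_above b) as [d bd].
    destruct (le_or_lt c d); [exists d|exists c]; eauto.
  - intros x [[y yx] _] H. destruct (H y yx) as [c [? [? ?]]]. eauto.
Qed.

Lemma club_acc D : club lt D -> club lt (acc D).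
Proof.
  intros HD. split.
  - intros a.
    destruct (omega_closure (fun _ => True) (fun x y => exists c, D c /\ x << c /\ c << y))
      with (a := a) as [x [b [_ [ab [lim [Hx cof]]]]]]; auto.
    + intros f _. destruct (bounded_nat f) as [b Hb]. eauto.
    + intros c _. destruct (proj1 HD c) as [d [? ?]]. destruct (unbounded_above d) as [e ?].
      exists e. split; [auto|]. split; [eauto|]. eauto.
    + exists b. split; auto. split; auto. intros y yb. destruct (cof y yb) as [n yn].
      destruct (Hx n) as [_ [_ [c [Dc [xc cx]]]]]. exists c. split; auto. split; [eauto|].
      apply lt_trans with (x (S n)); auto. apply Hx.
  - intros a lim H. split; auto. intros b ba. destruct (H b ba) as [c [[_ hc] [bc ca]]].
    destruct (hc b bc) as [d [? [? ?]]]. eauto.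
Qed.

Lemma stationary_club X C : stationary lt X -> club lt C -> stationary lt (fun x => X x /\ C x).
Proof.
  intros HX HC D HD. destruct (HX (fun x => C x /\ D x)) as [a [? [? ?]]]; eauto.
  now apply club_inter.
Qed.

Lemma not_stationary X : ~ stationary lt X -> exists C, club lt C /\ forall x, C x -> ~ X x.
Proof.
  intros N. apply NNPP. intros n. apply N. intros C HC. apply NNPP. intros n'.
  apply n. exists C. split; auto. intros x Cx Xx. eauto.
Qed.

Lemma stationary_mono (X Y : K -> Prop) :
  stationary lt X -> (forall x, X x -> Y x) -> stationary lt Y.
Proof. intros HX H C HC. destruct (HX C HC) as [a [? ?]]. eauto. Qed.

(** * Normal ideals and ascending towers *)

Lemma exists_bottom : exists o : K, forall x, le o x.
Proof. destruct (least (fun _ => True)) as [o [_ Ho]]; eauto. Qed.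

(** Closure under diagonal unions modulo a club; constant and two-valued families [X] give subsets
    and finite unions. *)
Definition normal_ideal (Q : (K -> Prop) -> Prop) : Prop :=
  Q (fun _ => False) /\
  forall X : K -> K -> Prop, (forall b, Q (X b)) -> forall Y E, club lt E ->
    (forall d, E d -> Y d -> exists b, b << d /\ X b d) -> Q Y.

Lemma normal_ideal_subset Q X Y :
  normal_ideal Q -> Q X -> (forall x, Y x -> X x) -> Q Y.
Proof.
  intros [_ H] QX sub. destruct exists_bottom as [o Ho].
  apply (H (fun _ => X) (fun _ => QX) Y _ (club_tail o)). eauto.
Qed.

Lemma normal_ideal_union Q X Y :
  normal_ideal Q -> Q X -> Q Y -> Q (fun x => X x \/ Y x).
Proof.
  intros HQ QX QY. destruct exists_bottom as [o Ho]. destruct (unbounded_above o) as [u ou].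
  apply (proj2 HQ (fun b x => b = o /\ X x \/ b <> o /\ Y x)) with (E := fun x => u << x).
  - intros b. destruct (classic (b = o)).
    + apply (normal_ideal_subset Q X); auto. tauto.
    + apply (normal_ideal_subset Q Y); auto. tauto.
  - apply club_tail.
  - intros d ud [h|h]; [exists o|exists u]; split; eauto.
    right. split; auto. intros ->. now apply lt_irrefl in ou.
Qed.

(* If the choice [X |-> F X] of a positive set outside [X] never stopped, then diagonal unions
   along kappa^+ would produce an ascending tower. *)
Lemma normal_ideal_maximum (S : K -> Prop) (Q : (K -> Prop) -> Prop) :
  (~ exists (I : Type) (r : I -> I -> Prop) (A : I -> K -> Prop),
      ordertype_kplus K r /\ asc_tower (NS_restr lt S) (bounded_ideal lt) r A) ->
  normal_ideal Q ->
  exists X, Q X /\ forall Y, Q Y -> ~ stationary lt (fun x => (Y x /\ ~ X x) /\ S x).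
Proof.
  intros notower HQ. apply NNPP. intros N.
  destruct (choice _ _ (fun X Y : K -> Prop =>
      Q X -> Q Y /\ stationary lt (fun x => (Y x /\ ~ X x) /\ S x))) as [F HF].
  { intros X. destruct (classic (Q X)) as [QX|n]; [|exists X; tauto].
    apply NNPP. intros n. apply N. exists X. split; auto. intros Y QY st. apply n. eauto. }
  destruct (exists_kplus K) as [I [r [rwo [rsmall rbig]]]].
  destruct (choice _ _ (fun i (f : I -> K) =>
      forall j k, r j i -> r k i -> f j = f k -> j = k)) as [e He].
  { intros i. destruct (rsmall i) as [f Hf].
    exists (fun j => match excluded_middle_informative (r j i) with
                     | left h => f (exist _ j h) | right _ => t end).
    intros j k hj hk. destruct excluded_middle_informative as [h|]; [|tauto].
    destruct excluded_middle_informative as [h'|]; [|tauto].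
    intros E. apply Hf in E. now injection E. }
  (* [B i] is the diagonal union, along the injection [e i] of the predecessors of [i] into kappa,
     of the sets [B j] together with [F (B j)]. *)
  destruct (transfinite_recursion I (K -> Prop) r (proj2 (proj2 (proj2 rwo)))
    (fun i R d => exists j P, R j P /\ e i j << d /\ (P d \/ F P d))) as [B HB].
  assert (BE : forall i d, B i d <-> exists j, r j i /\ e i j << d /\ (B j d \/ F (B j) d)).
  { intros i d. rewrite HB. split.
    - intros [j [P [[h ->] H]]]. eauto.
    - intros [j [h H]]. exists j, (B j). eauto. }
  assert (QB : forall i, Q (B i)).
  { intros i. induction (proj2 (proj2 (proj2 rwo)) i) as [i _ IH].
    apply (proj2 HQ (fun b d => exists j, r j i /\ e i j = b /\ (B j d \/ F (B j) d)))
      with (E := fun x => t << x).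
    - intros b. destruct (classic (exists j, r j i /\ e i j = b)) as [[j [ji ej]]|n].
      + apply (normal_ideal_subset Q (fun d => B j d \/ F (B j) d)); auto.
        * apply normal_ideal_union; auto. now apply HF, IH.
        * intros d [k [ki [ek H]]]. assert (k = j) as -> by (apply (He i); congruence). exact H.
      + apply (normal_ideal_subset Q (fun _ => False)); auto; [apply HQ|].
        intros d [k [ki [ek H]]]. eauto.
    - apply club_tail.
    - intros d _ Bd. apply BE in Bd. destruct Bd as [j [ji [ed H]]]. eauto 6. }
  (* [B i] itself is empty at the least index, hence not positive; adding [F (B i)] repairs this. *)
  apply notower. exists I, r, (fun i d => B i d \/ F (B i) d).
  split; [split; auto|]. split.
  - intros i n. apply n. eapply stationary_mono; [apply (HF (B i)), QB|]. simpl. tauto.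
  - intros i j ij.
    (* Beyond [e j i] the stage [i] set is absorbed by [B j]. So one difference is bounded, and the
       other contains a tail of [F (B j)] minus [B j]. *)
    assert (key : forall x, e j i << x -> B i x \/ F (B i) x -> B j x).
    { intros x ex H. apply BE. eauto. }
    split.
    + destruct (unbounded_above (e j i)) as [b eb]. exists b.
      intros x [H n]. apply le_lt_trans with (e j i); auto. apply not_lt_le. eauto.
    + intros n. apply n.
      eapply stationary_mono;
        [apply stationary_club; [apply (HF (B j)), QB|apply (club_tail (e j i))]|].
      unfold setminus. simpl. intros x [[[Fx nB] Sx] ex]. intuition eauto.
Qed.

(** When [F D] lies inside [acc D], the sequence decreases and its value at a limit index is the
    intersection of the earlier values. *)
Lemma club_sequence (F : (K -> Prop) -> K -> Prop) :
  (forall D, club lt D -> club lt (F D)) ->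
  exists D : K -> K -> Prop, (forall i, club lt (D i)) /\
    forall i x, D i x <-> forall j, j << i -> F (D j) x.
Proof.
  intros HF.
  destruct (transfinite_recursion K (K -> Prop) lt lt_wf
    (fun i R x => forall P j, R j P -> F P x)) as [D HD].
  assert (DE : forall i, D i = fun x => forall j, j << i -> F (D j) x).
  { intros i. apply functional_extensionality. intros x. apply propositional_extensionality.
    rewrite HD. split.
    - intros H j ji. apply (H (D j) j). now exists ji.
    - intros H P j [ji ->]. auto. }
  exists D. split.
  - intros i. induction (lt_wf i) as [i _ IH]. rewrite DE.
    apply (club_inter_below i (fun j => F (D j))). auto.
  - intros i x. now rewrite (DE i).
Qed.

Lemma bounded_of_not_cofinal g a (f : K -> K) :
  ~ cofinal_from lt g a -> (forall i, i << g -> f i << a) ->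
  exists b, b << a /\ forall i, i << g -> f i << b.
Proof.
  intros nc Hf. apply NNPP. intros N. apply nc.
  exists (fun i => f (proj1_sig i)). split.
  - intros [i ig]. auto.
  - intros b ba. apply NNPP. intros n. apply N. exists b. split; auto.
    intros i ig. destruct (le_or_lt b (f i)); auto. destruct n. now exists (exist _ i ig).
Qed.

(** * Sets of fewer than rho ordinals, and ladders *)

Section Guessing.
Variables theta rho : K.
Hypothesis Htr : theta << rho.
Hypothesis Hrho : regular_infinite lt rho.
Local Notation big := (E_ge lt rho).

Lemma regular_bounded g (f : K -> K) : g << rho -> (forall i, i << g -> f i << rho) ->
  exists b, b << rho /\ forall i, i << g -> f i << b.
Proof. intros gr. apply bounded_of_not_cofinal. now apply Hrho. Qed.

Lemma not_cofinal_big g a : big a -> g << rho -> ~ cofinal_from lt g a.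
Proof. intros [_ [c [[_ H] rc]]] gr. eauto. Qed.

(** As [rho] is regular, this says that [X] has fewer than [rho] elements; in this form unions need
    no cardinal arithmetic. *)
Definition small (X : K -> Prop) : Prop :=
  forall g : K -> K, (forall x, X x -> g x << rho) ->
    exists b, b << rho /\ forall x, X x -> g x << b.

Lemma small_subset X Y : small X -> (forall x, Y x -> X x) -> small Y.
Proof.
  intros HX sub g Hg.
  (* Outside [Y] any value below [rho] will do; [theta] is one. *)
  destruct (HX (fun x => if excluded_middle_informative (Y x) then g x else theta)) as [b [br Hb]].
  - intros x _. destruct excluded_middle_informative; auto.
  - exists b. split; auto. intros x Yx. specialize (Hb x (sub x Yx)).
    destruct excluded_middle_informative; tauto.
Qed.

Lemma small_union X (Y : K -> K -> Prop) :
  small X -> (forall x, X x -> small (Y x)) -> small (fun y => exists x, X x /\ Y x y).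
Proof.
  intros HX HY g Hg.
  destruct (choice _ _ (fun x b => X x -> b << rho /\ forall y, Y x y -> g y << b)) as [h Hh].
  { intros x. destruct (classic (X x)) as [Xx|n]; [|exists x; tauto].
    destruct (HY x Xx g) as [b Hb]; eauto. }
  destruct (HX h) as [b [br Hb]].
  - intros x Xx. now apply Hh.
  - exists b. split; auto. intros y [x [Xx Yxy]]. apply lt_trans with (h x); auto.
    now apply Hh.
Qed.

Lemma small_image g (f : initseg lt g -> K) : g << rho -> small (fun x => exists d, x = f d).
Proof.
  intros gr h Hh.
  destruct (regular_bounded g (fun i => match excluded_middle_informative (i << g) with
                 | left p => h (f (exist _ i p)) | right _ => theta end)) as [b [br Hb]]; auto.
  - intros i ig. destruct excluded_middle_informative; eauto.
  - exists b. split; auto. intros x [[i ig] ->]. specialize (Hb i ig).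
    destruct excluded_middle_informative as [p|]; [|tauto].
    now rewrite (proof_irrelevance _ ig p).
Qed.

Lemma small_empty : small (fun _ => False).
Proof. intros g _. exists theta. now split. Qed.

Lemma small_singleton a : small (fun x => x = a).
Proof.
  intros g Hg. destruct (proj2 (proj1 Hrho) (g a)) as [c [? ?]]; auto.
  exists c. split; auto. now intros x ->.
Qed.

Lemma small_or X Y : small X -> small Y -> small (fun x => X x \/ Y x).
Proof.
  intros HX HY g Hg. destruct (HX g) as [b [br Hb]]; auto.
  destruct (HY g) as [c [cr Hc]]; auto.
  destruct (max_lt _ _ _ br cr) as [m [mr [bm cm]]].
  exists m. split; auto. intros x [h|h]; eauto.
Qed.

(** The ladder is the range of a cofinal map of least possible length; that length is the cofinality
    of [a], which is below [rho] when [a] is a limit and not [big]. *)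
Lemma exists_ladders : exists e : K -> K -> Prop, forall a,
  small (e a) /\ (forall x, e a x -> x << a) /\
  (is_limit a -> ~ big a -> forall b, b << a -> exists x, e a x /\ le b x).
Proof.
  apply (choice _ _ (fun a (X : K -> Prop) => small X /\ (forall x, X x -> x << a) /\
           (is_limit a -> ~ big a -> forall b, b << a -> exists x, X x /\ le b x))).
  intros a. destruct (classic (is_limit a /\ ~ big a)) as [[lim nb]|n].
  - destruct (least (fun g => cofinal_from lt g a)) as [g [[f [fa cof]] Hg]].
    + exists a. exists (fun i => proj1_sig i). split; [intros [i ia]; exact ia|].
      intros b ba. exists (exist _ b ba). auto.
    + exists (fun x => exists d, x = f d). split; [|split].
      * apply small_image. destruct (le_or_lt rho g) as [h|]; auto. destruct nb.
        split; auto. exists g. split; auto. split; [now exists f|].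
        intros c cg cc. exact (le_not_lt _ _ (Hg c cc) cg).
      * intros x [d ->]. auto.
      * intros _ _ b ba. destruct (cof b ba) as [d Hd]. eauto.
  - exists (fun _ => False). split; [apply small_empty|]. tauto.
Qed.

(** * Shelah's club guessing *)

Definition floor (D : K -> Prop) (x a : K) : Prop :=
  D a /\ le a x /\ forall d, D d -> le d x -> le d a.

Lemma floor_exists D x : club lt D -> (exists d, D d /\ le d x) -> exists a, floor D x a.
Proof.
  intros HD [d0 [Dd0 d0x]].
  destruct (sup_exists (fun d => D d /\ le d x) x) as [s [sx [us ls]]]; [tauto|].
  exists s. split; [|split]; auto. apply NNPP. intros n.
  assert (ne : forall d, D d -> le d x -> d << s).
  { intros d Dd dx. destruct (us d) as [h| ->]; auto. tauto. }
  apply n, club_acc_in; auto. split.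
  - split; [eauto|]. intros b bs. destruct (ls b bs) as [c [[? ?] ?]]. eauto.
  - intros b bs. destruct (ls b bs) as [c [[? ?] ?]]. eauto.
Qed.

Lemma floor_unique D x a b : floor D x a -> floor D x b -> a = b.
Proof. intros [? [? ?]] [? [? ?]]. apply le_antisym; auto. Qed.

Section Ladders.
Variable e : K -> K -> Prop.
Hypothesis e_small : forall a, small (e a).
Hypothesis e_below : forall a x, e a x -> x << a.
Hypothesis e_cofinal : forall a, is_limit a -> ~ big a ->
  forall b, b << a -> exists x, e a x /\ le b x.

(* Shelah's "filling in": an ordinal is first pushed down to its floor in [D]; when that floor
   has small cofinality, its ladder is added as well. *)
Inductive reach (D C : K -> Prop) : K -> Prop :=
| reach_base x : C x -> reach D C x
| reach_step x a y : reach D C x -> floor D x a -> e a y -> reach D C y.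

(** Induction on [x]: the floor of [x] is unique, so the first step leads into a single ladder, and
    that ladder is small and lies below [x]. *)
Lemma reach_small_single D x : small (reach D (fun y => y = x)).
Proof.
  induction (lt_wf x) as [x _ IH].
  apply small_subset with (fun y => y = x \/
    exists z, (exists a, floor D x a /\ e a z) /\ reach D (fun y => y = z) y).
  - apply small_or; [apply small_singleton|]. apply small_union.
    + destruct (classic (exists a, floor D x a)) as [[a fa]|n].
      * apply small_subset with (e a); auto. intros z [b [fb ez]].
        now rewrite (floor_unique _ _ _ _ fa fb).
      * apply small_subset with (1 := small_empty). intros z [a [fa _]]. eauto.
    + intros z [a [[_ [ax _]] ez]]. apply IH. eauto.
  - intros y H. induction H as [y ->|y a z _ [->|[w [Hw IHw]]] fa ez]; [auto| |].
    + right. exists z. split; [eauto|]. now apply reach_base.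
    + right. exists w. split; auto. eapply reach_step; eauto.
Qed.

Lemma reach_small D C : small C -> small (reach D C).
Proof.
  intros HC. apply small_subset with (fun y => exists x, C x /\ reach D (fun z => z = x) y).
  - apply small_union; auto. intros x _. apply reach_small_single.
  - intros y H. induction H as [x Cx|x a y _ [z [Cz IH]] fa ey].
    + exists x. split; auto. now apply reach_base.
    + exists z. split; auto. eapply reach_step; eauto.
Qed.

(** The guessing set for [d]. Limit floors of cofinality below [rho] are left out, since their
    ladders lead on to further floors. *)
Definition trace (D : K -> Prop) (d a : K) : Prop :=
  big a /\ exists x, reach D (e d) x /\ floor D x a.

Lemma reach_below D d x : reach D (e d) x -> x << d.
Proof.
  induction 1 as [x h|x a y _ IH [_ [ax _]] ey]; [auto|].
  apply e_below in ey. eauto.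
Qed.

Definition good (N : K -> Prop) (d : K) : Prop :=
  (forall x, N x -> big x /\ x << d) /\ forall b, b << d -> exists x, N x /\ b << x.

(** As the clubs shrink, the floor of [x] can only decrease, so it is eventually constant; the final
    value lies in every [D i] with [i << rho], hence in [D rho]. *)
Lemma floor_stabilizes (D : K -> K -> Prop) x :
  (forall i j y, i << j -> D j y -> D i y) ->
  (forall i, club lt (D i)) ->
  (forall y, (forall i, i << rho -> D i y) -> D rho y) ->
  exists i, i << rho /\ forall j a, le i j -> j << rho -> floor (D j) x a -> floor (D rho) x a.
Proof.
  intros dec Dclub Dlim.
  assert (dec' : forall i j y, le i j -> D j y -> D i y).
  { intros i j y [h| ->]; eauto. }
  (* Once some [D i] has no element up to [x], later floors do not exist and the claim is
     vacuous. *)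
  destruct (classic (exists i, i << rho /\ ~ exists d, D i d /\ le d x)) as [[i [ir n]]|ne].
  { exists i. split; auto. intros j a ij jr [Da [ax _]]. destruct n. eauto. }
  destruct (least (fun a => exists i, i << rho /\ floor (D i) x a)) as [a [[i [ir fa]] min]].
  { destruct (floor_exists (D theta) x) as [a fa]; auto.
    - apply NNPP. intros n. apply ne. eauto.
    - eauto. }
  assert (st : forall j b, le i j -> j << rho -> floor (D j) x b -> b = a).
  { intros j b ij jr fb. apply le_antisym.
    - destruct fb as [? [? ?]]. apply fa; eauto.
    - eauto. }
  assert (Da : D rho a).
  { apply Dlim. intros j jr. destruct (max_lt _ _ _ ir jr) as [m [mr [im jm]]].
    apply dec' with m; auto. destruct (floor_exists (D m) x) as [b fb]; auto.
    - apply NNPP. intros n. apply ne. eauto.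
    - rewrite <- (st m b); auto. apply fb. }
  exists i. split; auto. intros j b ij jr fb. rewrite (st j b); auto.
  split; auto. split; [apply fa|]. intros d Dd dx. apply fa; eauto.
Qed.

(** If every [D] failed, some club [F D] inside [acc D] would refute the good traces of [D] at all
    points of [S] in [F D]. Iterate this [rho] times and take [d] in [S] and [D rho]. Only fewer
    than [rho] ordinals are reached from [d], so their floors have all settled at one stage
    [i << rho]. The trace of [D i] then lies in [D rho], hence in [F (D i)], a contradiction. *)
Lemma club_guessing (S : K -> Prop) :
  (forall d, S d -> is_limit d /\ ~ big d) -> stationary lt S ->
  exists D, club lt D /\ forall D', club lt D' ->
    stationary lt (fun d => S d /\ good (trace D d) d /\ forall x, trace D d x -> D' x).
Proof.
  intros HS Sst. apply NNPP. intros N.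
  assert (step : forall D, club lt D -> exists F, club lt F /\ (forall x, F x -> acc D x) /\
     forall d, S d -> F d -> good (trace D d) d -> ~ forall x, trace D d x -> F x).
  { intros D HD. apply NNPP. intros n. apply N. exists D. split; auto. intros D' HD'.
    apply NNPP. intros ns. apply not_stationary in ns. destruct ns as [E [HE Hdis]].
    apply n. exists (fun x => (D' x /\ E x) /\ acc D x). split.
    - apply club_inter; [now apply club_inter|now apply club_acc].
    - split; [tauto|]. intros d Sd [[_ Ed] _] g H. apply (Hdis d Ed). split; auto. split; auto.
      intros x Hx. now apply H. }
  destruct (choice _ _ (fun D F => club lt D -> club lt F /\ (forall x, F x -> acc D x) /\
     forall d, S d -> F d -> good (trace D d) d -> ~ forall x, trace D d x -> F x)) as [F HF].
  { intros D. destruct (classic (club lt D)) as [c|n]; [|exists D; tauto].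
    destruct (step D c) as [E HE]. eauto. }
  destruct (club_sequence F) as [D [Dclub DE]]; [intros; now apply HF|].
  assert (dec : forall i j y, i << j -> D j y -> D i y).
  { intros i j y ij Dy. apply (proj1 (DE j y)) with (j := i) in Dy; auto.
    apply club_acc_in; auto. now apply HF. }
  assert (Dlim : forall y, (forall i, i << rho -> D i y) -> D rho y).
  { intros y Hy. apply DE. intros j jr. destruct (proj2 (proj1 Hrho) j jr) as [k [jk kr]].
    apply (proj1 (DE k y)); auto. }
  destruct (Sst (D rho)) as [d [Sd Dd]]; auto.
  destruct (choice _ _ (fun x i => i << rho /\ forall j a, le i j -> j << rho ->
     floor (D j) x a -> floor (D rho) x a)) as [h Hh].
  { intros x. now apply floor_stabilizes. }
  (* One stage [i] beyond the settling stages [h x] of all reached [x]. *)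
  destruct (reach_small (D rho) (e d) (e_small d) h) as [i [ir Hi]].
  { intros x _. apply Hh. }
  assert (sub : forall x, reach (D i) (e d) x -> reach (D rho) (e d) x).
  { induction 1 as [x ex|x a y _ IH fa ey]; [now apply reach_base|].
    apply reach_step with x a; auto. apply (proj2 (Hh x) i); auto. }
  assert (fl : forall x a, reach (D i) (e d) x -> floor (D i) x a -> D rho a).
  { intros x a Hx fa. apply sub in Hx. apply (proj2 (Hh x) i a) in fa; auto. apply fa. }
  assert (DF : forall x, D rho x -> F (D i) x).
  { intros x Dx. now apply (proj1 (DE rho x)). }
  assert (limi : forall x, D rho x -> acc (D i) x).
  { intros x Dx. apply HF; auto. }
  apply (proj2 (proj2 (HF (D i) (Dclub i))) d Sd (DF d Dd)).
  - split.
    + intros x [bx [y [Hy [_ [xy _]]]]]. split; auto. apply reach_below in Hy. eauto.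
    + intros b bd. destruct (HS d Sd) as [ld nd].
      (* The floor of the least such [x] is [big]: otherwise its ladder would provide a smaller
         reached ordinal whose floor is still above [b]. *)
      destruct (least (fun x => reach (D i) (e d) x /\ exists a, floor (D i) x a /\ b << a))
        as [x [[Hx [a [fa ba]]] min]].
      { destruct (limi d Dd) as [_ cof]. destruct (cof b bd) as [c [Dc [bc cd]]].
        destruct (e_cofinal d ld nd c cd) as [x [ex cx]]. exists x. split; [now apply reach_base|].
        destruct (floor_exists (D i) x) as [a fa]; eauto. exists a. split; auto.
        apply lt_le_trans with c; auto. apply fa; auto. }
      exists a. split; auto. split; [|eauto]. apply NNPP. intros nb.
      destruct (limi a (fl x a Hx fa)) as [la cof]. destruct (cof b ba) as [c [Dc [bc ca]]].
      destruct (e_cofinal a la nb c ca) as [y [ey cy]].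
      apply (le_not_lt x y).
      * apply min. split; [eapply reach_step; eauto|].
        destruct (floor_exists (D i) y) as [a' fa']; eauto. exists a'. split; auto.
        apply lt_le_trans with c; auto. apply fa'; auto.
      * apply e_below in ey. destruct fa as [_ [ax _]]. eauto.
  - intros x [_ [y [Hy fx]]]. eauto.
Qed.

End Ladders.

(** * Guessing modulo bounded sets *)

Definition almost (N : K -> Prop) (d : K) (D : K -> Prop) : Prop :=
  exists b, b << d /\ forall x, N x -> b << x -> D x.

Definition guesses (N : K -> Prop) (d : K) (D : K -> Prop) : Prop := good N d /\ almost N d D.

(** Points above [b] of the diagonal intersection lie in [D b]. The exceptions that [almost]
    tolerates absorb the points up to [b]. *)
Lemma guesses_diagonal N d (D : K -> K -> Prop) b :
  guesses N d (fun x => forall i, i << x -> D i x) -> b << d -> guesses N d (D b).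
Proof.
  intros [g [c [cd H]]] bd. split; auto. destruct (max_lt _ _ _ bd cd) as [m [md [bm cm]]].
  exists m. split; auto. intros x Nx mx. apply H; eauto.
Qed.

Lemma guesses_mono N d (D E : K -> Prop) :
  guesses N d D -> (forall x, D x -> E x) -> guesses N d E.
Proof. intros [g [b [bd H]]] DE. split; auto. exists b. auto. Qed.

Definition guessed_everywhere (N : K -> K -> Prop) (X : K -> Prop) : Prop :=
  forall D, club lt D -> exists E, club lt E /\ forall d, E d -> X d -> guesses (N d) d D.

(** At [d] use the guessing set belonging to some index [b << d] with [d] in [X b]; the diagonal
    intersection of the clubs for the separate indices then works. *)
Lemma normal_ideal_guessed : normal_ideal (fun X => exists N, guessed_everywhere N X).
Proof.
  split.
  - exists (fun _ _ => False). intros D HD. exists D. split; tauto.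
  - intros X HX Y E HE cover.
    destruct (choice _ _ (fun b N => guessed_everywhere N (X b)) HX) as [N HN].
    destruct (choice _ _ (fun d b => E d -> Y d -> b << d /\ X b d)) as [f Hf].
    { intros d. destruct (classic (E d /\ Y d)) as [[Ed Yd]|n]; [|exists d; tauto].
      destruct (cover d Ed Yd) as [b Hb]. eauto. }
    exists (fun d => N (f d) d). intros D HD.
    destruct (choice _ _ (fun b C => club lt C /\ forall d, C d -> X b d -> guesses (N b d) d D))
      as [C HC].
    { intros b. now apply HN. }
    exists (fun d => E d /\ forall b, b << d -> C b d). split.
    + apply club_inter; auto. apply club_diagonal. apply HC.
    + intros d [Ed Hd] Yd. destruct (Hf d Ed Yd) as [fd Xd]. apply (HC (f d)); auto.
Qed.

(** The diagonal intersection of the refuting clubs refutes: by [guesses_diagonal], guessing it at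
    [d] means guessing each term with index below [d]. *)
Lemma normal_ideal_not_guessing (N : K -> K -> Prop) :
  normal_ideal (fun X => exists D, club lt D /\ forall d, D d -> X d -> ~ guesses (N d) d D).
Proof.
  split.
  - exists (fun x => t << x). split; [apply club_tail|tauto].
  - intros X HX Y E HE cover. apply (choice _ _ _) in HX. destruct HX as [D HD].
    exists (fun d => (forall b, b << d -> D b d) /\ E d). split.
    + apply club_inter; auto. apply club_diagonal. apply HD.
    + intros d [Hd Ed] Yd g. destruct (cover d Ed Yd) as [b [bd Xd]].
      apply (proj2 (HD b) d); auto. apply guesses_diagonal; auto.
      apply guesses_mono with (1 := g). tauto.
Qed.

(** Let [X] be a largest set guessed everywhere, and suppose that [S] minus [X] is stationary. Club
    guessing there gives traces; let [Y] be a largest set on which they fail, refuted by the club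
    [D1]. The set [Z] of points of [S] outside [X] at which the trace guesses [D1] is stationary and
    misses [Y] on [D1]. Hence on [Z] the traces guess every club, against the choice of [X]. *)
Lemma uniform_guessing (S : K -> Prop) :
  (~ exists (I : Type) (r : I -> I -> Prop) (A : I -> K -> Prop),
      ordertype_kplus K r /\ asc_tower (NS_restr lt S) (bounded_ideal lt) r A) ->
  (forall d, S d -> is_limit d /\ ~ big d) ->
  exists N, guessed_everywhere N S.
Proof.
  intros notower HS.
  destruct exists_ladders as [e He].
  destruct (normal_ideal_maximum S _ notower normal_ideal_guessed) as [X [[N HN] max]].
  assert (ns : ~ stationary lt (fun d => S d /\ ~ X d)).
  { intros st.
    destruct (club_guessing e (fun a => proj1 (He a)) (fun a => proj1 (proj2 (He a)))
      (fun a => proj2 (proj2 (He a))) (fun d => S d /\ ~ X d)) as [D0 [HD0 guess]]; auto.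
    { intros d [Sd _]. auto. }
    destruct (normal_ideal_maximum S _ notower (normal_ideal_not_guessing (trace e D0)))
      as [Y [[D1 [HD1 HY]] maxY]].
    set (Z := fun d => (S d /\ ~ X d) /\ guesses (trace e D0 d) d D1).
    assert (HZ : exists N, guessed_everywhere N Z).
    { exists (trace e D0). intros D HD.
      destruct (not_stationary _ (maxY (fun d => Z d /\ ~ guesses (trace e D0 d) d D)
        (ex_intro _ D (conj HD (fun d _ Hd => proj2 Hd))))) as [E [HE dis]].
      exists (fun x => E x /\ D1 x). split; [now apply club_inter|].
      intros d [Ed Dd] Zd. apply NNPP. intros n. apply (dis d Ed). split; [|apply Zd].
      split; [auto|]. intros Yd. apply (HY d Dd Yd). apply Zd. }
    apply (max Z HZ). apply stationary_mono with (1 := guess D1 HD1).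
    intros d [SX [g sub]]. unfold Z. split; [split|]; [|tauto|tauto].
    split; [auto|]. split; [auto|]. destruct SX as [Sd _]. destruct (HS d Sd) as [[[b bd] _] _].
    exists b. auto. }
  apply not_stationary in ns. destruct ns as [E0 [HE0 dis]].
  exists N. intros D HD. destruct (HN D HD) as [E [HE H]].
  exists (fun x => E x /\ E0 x). split; [now apply club_inter|].
  intros d [Ed E0d] Sd. apply H; auto. apply NNPP. intros n. apply (dis d E0d). auto.
Qed.

(** An increasing omega-sequence in [lam] allows [f] to be reindexed by [lam]. *)
Lemma bounded_nat_below lam x (f : nat -> K) :
  is_limit lam -> ~ cofinal_from lt lam x -> (forall n, f n << x) ->
  exists b, b << x /\ forall n, f n << b.
Proof.
  intros lim nc Hf. destruct (increasing_sequence_below lam lim) as [s [sl inc]].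
  destruct (choice _ _ (fun i n => forall m, s m = i -> m = n)) as [p Hp].
  { intros i. destruct (classic (exists m, s m = i)) as [[m <-]|n].
    - exists m. intros k. now apply increasing_injective.
    - exists 0. intros m hm. destruct n. eauto. }
  destruct (bounded_of_not_cofinal lam x (fun i => f (p i))) as [b [bx Hb]]; auto.
  exists b. split; auto. intros n. rewrite (Hp (s n) n); auto.
Qed.

(* The least [gamma] of cofinality at least [rho] in [E lam] and [acc (E lam)] would be
   undercut: [S] reflects at [gamma], so some [d] in [S] below [gamma] guesses [E lam], and the
   guessing set of [d] contains a smaller such ordinal. *)
Lemma no_uniform_guessing (S : K -> Prop) (N : K -> K -> Prop) lam :
  stationary lt S -> reflects_fully lt S big ->
  is_limit lam -> lam << rho ->
  (forall d (P : K -> K -> Prop), S d -> (forall i j b, i << j -> P j b -> P i b) ->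
     (forall i b c, b << c -> P i b -> P i c) ->
     (forall i, i << lam -> exists b, b << d /\ P i b) ->
     exists b, b << d /\ forall i, i << lam -> P i b) ->
  ~ guessed_everywhere N S.
Proof.
  intros Sst [G [HG refl]] llim lr pigeon HN.
  destruct (choice _ _ (fun D E => club lt D ->
    club lt E /\ forall d, E d -> S d -> guesses (N d) d D)) as [F HF].
  { intros D. destruct (classic (club lt D)) as [c|n]; [|exists D; tauto].
    destruct (HN D c) as [E HE]. eauto. }
  (* Intersecting with [G] ensures that [S] reflects at the least point [g] found below. *)
  destruct (club_sequence (fun D x => (F D x /\ acc D x) /\ G x)) as [E [Eclub EE]].
  { intros D HD. apply club_inter; auto. apply club_inter; [now apply HF|now apply club_acc]. }
  assert (dec : forall i j x, i << j -> E j x -> E i x).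
  { intros i j x ij Ex. apply club_acc_in; auto. now apply (proj1 (EE j x)). }
  assert (Elim : forall x, (forall i, i << lam -> E i x) ->
            E lam x /\ forall i, i << lam -> acc (E i) x).
  { intros x Hx.
    assert (H : forall j, j << lam -> (F (E j) x /\ acc (E j) x) /\ G x).
    { intros j jl. destruct (proj2 llim j jl) as [k [jk kl]]. apply (proj1 (EE k x)); auto. }
    split; [now apply EE|]. intros i il. now apply H. }
  assert (Eacc : forall x, big x -> (forall i, i << lam -> E i x) -> acc (E lam) x).
  { intros x bx Hx. destruct (Elim x Hx) as [_ Hacc]. split; [apply bx|].
    pose proof (not_cofinal_big lam x bx lr) as nc. intros b bb.
    (* The closing argument runs below [x]: since [lam] is not cofinal in [x], both omega-sequences
       and [lam]-families below [x] are bounded. *)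
    destruct (closing_point (fun y => y << x) (fun _ i => i << lam) E) with (a := b)
      as [c [cx [bc [_ Hc]]]]; auto.
    - intros f. now apply bounded_nat_below with lam.
    - intros y z; eauto.
    - intros c i [[a ac] _] il. eauto.
    - intros a f _. now apply bounded_of_not_cofinal.
    - intros a i ax il. destruct (Hacc i il) as [_ H]. destruct (H a ax) as [c [? [? ?]]]. eauto.
    - intros a i _ Ha. now apply club_acc_in.
    - exists c. split; [now apply Elim|auto]. }
  assert (below : forall d, S d -> E lam d ->
            exists x, x << d /\ E lam x /\ acc (E lam) x /\ big x).
  { intros d Sd Ed.
    assert (gi : forall i, i << lam -> guesses (N d) d (E i)).
    { intros i il. apply (HF (E i)); auto. now apply (proj1 (EE lam d)). }
    (* The bound past which [N d] lies in [E i] may depend on [i]; [pigeon] makes one bound serve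
       all [i << lam]. *)
    destruct (pigeon d (fun i b => forall x, N d x -> b << x -> E i x)) as [b [bd Hb]]; eauto.
    { intros i il. apply gi, il. }
    destruct llim as [[i il] _]. destruct (gi i il) as [[gN gcof] _].
    destruct (gcof b bd) as [x [Nx bx]]. destruct (gN x Nx) as [Bx xd].
    exists x. split; auto. split; [apply Elim; auto|]. split; auto. }
  destruct (least (fun x => E lam x /\ acc (E lam) x /\ big x)) as [g [[Eg [ag bg]] min]].
  { destruct (Sst (E lam)) as [d [Sd Ed]]; auto. destruct (below d Sd Ed) as [x Hx].
    exists x. tauto. }
  assert (Gg : G g).
  { destruct llim as [[i il] _]. now apply (proj1 (EE lam g) Eg i). }
  destruct (refl g Gg bg (fun x => E lam x /\ x << g)) as [d [dg [[Sd _] [Ed _]]]].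
  { split; [tauto|split].
    - intros b bb. destruct (proj2 ag b bb) as [c [? [? ?]]]. eauto.
    - intros a ag' la H. split; auto. apply club_acc_in; auto. split; auto.
      intros b ba. destruct (H b ba) as [c [[? ?] ?]]. eauto. }
  destruct (below d Sd Ed) as [x [xd Hx]]. specialize (min x Hx).
  apply (le_not_lt g x); eauto.
Qed.

End Guessing.

(** * Countable ordinals and the choice of [lam] *)

Definition countable (g : K) : Prop := card_le (initseg lt g) nat.

(** An ordinal below the least limit is the bottom or a successor, so by induction it is a finite
    iterate of the successor map. *)
Lemma countable_least_limit w :
  is_limit w -> (forall x, is_limit x -> le w x) -> countable w.
Proof.
  intros lim min.
  destruct (choice _ _ (fun a b => a << b /\ forall c, a << c -> le b c)) as [succ Hsucc].
  { intros a. apply least, unbounded_above. }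
  destruct exists_bottom as [o Ho].
  unfold countable. change (initseg lt w) with {x | x << w}.
  apply card_le_of_surjection with (fun n => Nat.iter n succ o).
  intros a. induction (lt_wf a) as [a _ IH]. intros aw.
  destruct (classic (exists b, b << a /\ forall c, b << c -> le a c)) as [[b [ba Hb]]|n].
  - destruct (IH b ba) as [k Hk]; eauto. exists (S k). simpl. rewrite Hk.
    apply le_antisym; [now apply Hsucc|]. apply Hb, Hsucc.
  - exists 0. simpl. destruct (Ho a) as [oa|]; auto.
    destruct (le_not_lt w a); auto. apply min. split; [eauto|].
    intros b ba. apply NNPP. intros n'. apply n. exists b. split; auto.
    intros c bc. apply not_lt_le. intros ca. eauto.
Qed.

Lemma least_uncountable_limit w :
  ~ countable w -> (forall x, x << w -> countable x) -> is_limit w.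
Proof.
  intros unc min. split.
  - apply NNPP. intros n. apply unc. exists (fun _ => 0).
    intros [x xw]. destruct n. eauto.
  - intros b bw. apply NNPP. intros n. apply unc.
    assert (top : forall x, x << w -> ~ x << b -> x = b).
    { intros x xw nx. apply not_lt_le in nx. destruct nx as [h|]; auto. destruct n. eauto. }
    destruct (min b bw) as [f Hf].
    (* The largest element [b] gets the code 0; the codes of the others are shifted by one. *)
    exists (fun x => match excluded_middle_informative (proj1_sig x << b) with
                     | left h => Datatypes.S (f (exist _ _ h)) | right _ => 0 end).
    intros [x xw] [y yw]. simpl.
    destruct excluded_middle_informative as [hx|hx];
      destruct excluded_middle_informative as [hy|hy]; intros E; try discriminate.
    + injection E as E. apply Hf in E. injection E as E. subst.
      now rewrite (proof_irrelevance _ xw yw).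
    + assert (x = y) by (rewrite (top x), (top y); auto). subst.
      now rewrite (proof_irrelevance _ xw yw).
Qed.

(** Regularity of omega_1: were [f] unbounded, each [x] below [w] would be coded by an index [i]
    with [x << f i] and by the code of [x] in the countable segment below [f i]. *)
Lemma least_uncountable_bounded w (I : Type) (f : I -> K) :
  ~ countable w -> (forall x, x << w -> countable x) ->
  card_le I nat -> (forall i, f i << w) -> exists b, b << w /\ forall i, f i << b.
Proof.
  intros unc min [j Hj] fw. apply NNPP. intros N. apply unc.
  destruct (choice _ _ (fun k (c : K -> nat) =>
    k << w -> forall x y, x << k -> y << k -> c x = c y -> x = y)) as [c Hc].
  { intros k. destruct (classic (k << w)) as [kw|n]; [|exists (fun _ => 0); tauto].
    destruct (min k kw) as [h Hh].
    exists (fun x => match excluded_middle_informative (x << k) with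
                     | left p => h (exist _ _ p) | right _ => 0 end).
    intros _ x y xk yk. destruct excluded_middle_informative as [p|]; [|tauto].
    destruct excluded_middle_informative as [q|]; [|tauto].
    intros E. apply Hh in E. now injection E. }
  destruct (choice _ _ (fun (x : initseg lt w) i => proj1_sig x << f i)) as [d Hd].
  { intros [x xw]. simpl.
    destruct (proj2 (least_uncountable_limit w unc min) x xw) as [y [xy yw]].
    apply NNPP. intros n. apply N. exists y. split; auto.
    intros i. destruct (le_or_lt y (f i)); auto. destruct n. eauto. }
  exists (fun x => to_nat (j (d x), c (f (d x)) (proj1_sig x))).
  intros x y E. apply to_nat_inj in E. injection E as E1 E2. apply Hj in E1.
  assert (exy : proj1_sig x = proj1_sig y).
  { apply (Hc (f (d x))); [apply fw|apply Hd|rewrite E1; apply Hd|]. now rewrite E1 in E2 |- *. }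
  destruct x as [x xw], y as [y yw]. simpl in exy. subst.
  now rewrite (proof_irrelevance _ xw yw).
Qed.

(* [lam] is omega when [theta] is uncountable, and omega_1 when [theta] is omega; in both cases
   its cofinality differs from [theta], so an increasing [lam]-sequence of bounds below an
   ordinal of cofinality [theta] is bounded. *)
Lemma exists_pigeonhole_length theta rho :
  is_limit theta -> theta << rho ->
  (uncountable_ord lt theta \/ exists g, g << rho /\ uncountable_ord lt g) ->
  exists lam, is_limit lam /\ lam << rho /\
    forall d (P : K -> K -> Prop), has_cf lt d theta -> (forall i j b, i << j -> P j b -> P i b) ->
     (forall i b c, b << c -> P i b -> P i c) ->
     (forall i, i << lam -> exists b, b << d /\ P i b) ->
     exists b, b << d /\ forall i, i << lam -> P i b.
Proof.
  intros tlim tr Hcase.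
  destruct (classic (uncountable_ord lt theta)) as [unc|cnt].
  - destruct (least is_limit) as [w [wlim wmin]]; [eauto|].
    assert (wt : w << theta).
    { destruct (wmin theta tlim) as [|e]; auto. destruct unc. rewrite <- e.
      now apply countable_least_limit. }
    exists w. split; auto. split; [eauto|].
    intros d P [_ nc] _ up H.
    destruct (choice _ _ (fun i b => i << w -> b << d /\ P i b)) as [h Hh].
    { intros i. destruct (classic (i << w)) as [iw|n]; [|exists w; tauto].
      destruct (H i iw) as [b Hb]. eauto. }
    destruct (bounded_of_not_cofinal w d h) as [b [bd Hb]]; [now apply nc|intros; now apply Hh|].
    exists b. split; auto. intros i iw. apply up with (h i); [auto|now apply Hh].
  - assert (tc : countable theta) by (apply NNPP; exact cnt).
    destruct Hcase as [|[g [gr gu]]]; [tauto|].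
    destruct (least (fun x => ~ countable x)) as [w [wu wmin]]; [eauto|].
    assert (wmin' : forall x, x << w -> countable x).
    { intros x xw. apply NNPP. intros n. exact (le_not_lt _ _ (wmin x n) xw). }
    exists w. split; [now apply least_uncountable_limit|]. split; [eauto|].
    intros d P [[f [fd fcof]] _] down up H. apply NNPP. intros N.
    (* If each term [f k] of the countable cofinal map fails at some [h k], a bound [i << w] of all
       [h k] is an index at which every [f k] fails, hence every [b << d]. *)
    destruct (choice _ _ (fun k i => i << w /\ ~ P i (f k))) as [h Hh].
    { intros k. apply NNPP. intros n. apply N. exists (f k). split; auto.
      intros i iw. apply NNPP. intros nP. apply n. eauto. }
    destruct (least_uncountable_bounded w _ h wu wmin' tc) as [i [iw Hi]]; [intros; now apply Hh|].
    destruct (H i iw) as [b [bd Pb]]. destruct (fcof b bd) as [k bk].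
    apply (proj2 (Hh k)). apply down with i; auto. destruct bk as [bk| <-]; eauto.
Qed.

End Kappa.

Theorem theorem5p12 (K : Type) (lt : K -> K -> Prop)
  (Hkappa : regular_uncountable lt)
  (theta rho : K)
  (Htheta : regular_infinite lt theta) (Hrho : regular_infinite lt rho)
  (Hthrho : lt theta rho)
  (S : K -> Prop)
  (HSstat : stationary lt S)
  (HSE : forall a, S a -> E_eq lt theta a)
  (Hrefl : reflects_fully lt S (E_ge lt rho))
  (Hcase : uncountable_ord lt theta \/ exists g, lt g rho /\ uncountable_ord lt g) :
  (exists (I : Type) (r : I -> I -> Prop) (A : I -> K -> Prop),
      ordertype_bkappa lt r /\ desc_tower (NS_restr lt S) (bounded_ideal lt) r A)
  \/
  (exists (I : Type) (r : I -> I -> Prop) (A : I -> K -> Prop),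
      ordertype_kplus K r /\ asc_tower (NS_restr lt S) (bounded_ideal lt) r A).
Proof.
  right. apply NNPP. intros notower.
  pose proof (proj1 Hkappa) as Hwo. destruct Htheta as [tlim _].
  destruct (uniform_guessing K lt Hwo Hkappa theta tlim theta rho Hthrho Hrho S notower)
    as [N HN].
  { intros d Sd. destruct (HSE d Sd) as [dlim [cof _]]. split; auto.
    intros bd. exact (not_cofinal_big K lt Hwo rho theta d bd Hthrho cof). }
  destruct (exists_pigeonhole_length K lt Hwo Hkappa theta tlim theta rho tlim Hthrho Hcase)
    as [lam [llim [lr pigeon]]].
  refine (no_uniform_guessing K lt Hwo Hkappa theta tlim rho S N lam HSstat Hrefl llim lr _ HN).
  intros d P Sd. apply pigeon. apply HSE, Sd.
Qed.
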